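(* Suppose $\mathbf F\subset\mathrm{Sym}^2(\mathbb R^n)$ is a conical ST-invariant subequation (invariant under a subgroup $G\subset \mathrm O(n)$ acting transitively on $S^{n-1}$) of finite Riesz characteristic $p$, $1\le p<\infty$, and let $\mathbf f\in C^\infty(\mathbf F)$ be a $G$-invariant degenerate elliptic operator which is homogeneous of degree $m>0$ and compatible with $\mathbf F$, i.e. $\partial\mathbf F=\{\mathbf f=0\}$. Set $$\alpha=\frac{n}{mp}\qquad\text{and}\qquad \varphi(|x|)=\mathbf f^{\alpha}(D^2_xK_1).$$ Then (and only for this value of the exponent) for all $\epsilon>0$ $$\mathbf f^\alpha\left(D^2_xK_\epsilon\right)=\frac1{\epsilon^n}\,\varphi\!\left(\frac{|x|}{\epsilon}\right)=:\varphi_\epsilon(x),$$ this function is integrable on $\mathbb R^n$, and it defines a (positive) radial approximate delta function with coefficient $c=\int_{\mathbb R^n}\varphi(|x|)\,dx$, i.e. $\varphi_\epsilon\,dx\to c\,\delta_0$ weakly as $\epsilon\to0$.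
   Context: $\mathrm{Sym}^2(\mathbb R^n)$ is the space of real symmetric $n\times n$ matrices. A cone subequation $\mathbf F\subset\mathrm{Sym}^2(\mathbb R^n)$ is a closed set with $\mathbf F+P\subset\mathbf F$ for all $P\ge0$ and $t\mathbf F\subset\mathbf F$ for $t\geq0$ (vertex at the origin). The operator $\mathbf f$ is degenerate elliptic if $\mathbf f(A+P)\ge\mathbf f(A)$ for $A\in\mathbf F$, $P\ge0$. $C^\infty(\mathbf F)$ means smooth up to the boundary. For $e\ne0$, $P_e$ is orthogonal projection onto the line $\mathbb Re$ and $P_{e^\perp}=I-P_e$. The Riesz characteristic of $\mathbf F$ is $p=p_{\mathbf F}=\sup\{q: P_{e^\perp}-(q-1)P_e\in\mathbf F\}\in[1,\infty]$, which by invariance does not depend on $e$; when it is finite, $P_{e^\perp}-(p-1)P_e\in\partial\mathbf F$. Let $k(t)=\frac1{2-p}t^{2-p}$ if $1\le p<2$, $k(t)=\log t$ if $p=2$, $k(t)=-\frac1{p-2}t^{-(p-2)}$ if $p>2$. The Riesz kernel is $K(x)=k(|x|)$, and for $\epsilon>0$, $K_\epsilon(x)=k\left(\sqrt{|x|^2+\epsilon^2}\right)$; $K_\epsilon\in C^\infty(\mathbb R^n)$, $D^2_xK_\epsilon\in\mathbf F$ for all $x$, and $K_\epsilon$ decreases pointwise to $K$ as $\epsilon\downarrow0$. ''Only for this value of the exponent'' means: if the displayed scaling identity with factor $\epsilon^{-n}$ holds for all $\epsilon>0$ with an exponent $\alpha'>0$ in place of $\alpha$ (and $\varphi$ defined with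 $\alpha'$), then $\alpha'=n/(mp)$. *)

(* Defs.v *)
From HB Require Import structures.
From mathcomp Require Import all_boot all_order all_algebra.
From mathcomp Require Import all_classical all_reals all_analysis.
Set Implicit Arguments.
Unset Strict Implicit.
Unset Printing Implicit Defensive.
Import Order.TTheory GRing.Theory Num.Theory numFieldNormedType.Exports.
Local Open Scope classical_set_scope.
Local Open Scope ring_scope.

(* The library equips [n.-tuple R] with the product sigma-algebra but with no
   measure.  Lebesgue measure on [n.+1.-tuple R] is the product of the
   one-dimensional Lebesgue measure and of Lebesgue measure on [n.-tuple R],
   transported along [(x, t) |-> x :: t]. *)
Section lebesgue_step.
Context {R : realType} (n : nat).
Variable mu : {sigma_finite_measure set (n.-tuple R) -> \bar R}.

Definition tuple_consp (u : measurableTypeR R * n.-tuple R) : n.+1.-tuple R :=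
  [tuple of u.1 :: u.2].

Lemma measurable_tuple_consp : measurable_fun setT tuple_consp.
Proof. exact: (measurable_cons measurable_fst measurable_snd). Qed.

Definition lebesgue_step : set (n.+1.-tuple R) -> \bar R :=
  pushforward (lebesgue_measure \x mu)%E tuple_consp.

Let m : {measure set (n.+1.-tuple R) -> \bar R} :=
  measure_function_pushforward__canonical__measure_function_Measure
    (lebesgue_measure \x mu)%E measurable_tuple_consp.

HB.instance Definition _ := isMeasure.Build _ _ _ lebesgue_step
  (measure0 m) (measure_ge0 m) (@measure_semi_sigma_additive _ _ _ m).

Lemma lebesgue_step_sigma_finite : sigma_finite setT lebesgue_step.
Proof.
have /sigma_finiteP[A' [A'T A'nd A'_fin]] := sigma_finiteT (@lebesgue_measure R).
have /sigma_finiteP[B' [B'T B'nd B'_fin]] := sigma_finiteT mu.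
pose F i := A' i `*` B' i.
have FT : setT = \bigcup_i F i.
  rewrite -setXTT A'T B'T predeqE => -[x y]; split.
    move=> [/= [k _ kx] [l _ ly]]; exists (maxn k l) => //; split.
    - by move: x kx; exact/subsetPset/A'nd/leq_maxl.
    - by move: y ly; exact/subsetPset/B'nd/leq_maxr.
  by move=> [k _ []/= ? ?]; split; exists k.
have F_fin i : measurable (F i) /\ ((lebesgue_measure \x mu) (F i) < +oo)%E.
  have [? ?] := A'_fin i; have [? ?] := B'_fin i.
  split; first exact: measurableX.
  by rewrite product_measure1E// lte_mul_pinfty// ge0_fin_numE.
pose uncons (t : n.+1.-tuple R) : measurableTypeR R * n.-tuple R :=
  (thead t, [tuple of behead t]).
have uncK : cancel tuple_consp uncons.
  move=> [x t]; apply: injective_projections => /=; first exact: theadE.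
  exact: val_inj.
have consK : cancel uncons tuple_consp.
  by move=> t; rewrite [RHS]tuple_eta; apply: val_inj.
have munc : measurable_fun setT uncons.
  apply/measurable_fun_pairP; split.
    exact: (@measurable_tnth _ (measurableTypeR R) n.+1 ord0).
  exact: measurable_behead.
exists (fun i => uncons @^-1` F i).
  by rewrite -preimage_bigcup -FT preimage_setT.
move=> i; have [mF Foo] := F_fin i; split.
  by rewrite -[X in measurable X]setTI; exact: munc.
rewrite /lebesgue_step /pushforward -comp_preimage.
by rewrite (_ : uncons \o tuple_consp = id)//; apply/funext.
Qed.

HB.instance Definition _ := Measure_isSigmaFinite.Build _ _ _ lebesgue_step
  lebesgue_step_sigma_finite.
End lebesgue_step.

Fixpoint lebesgue_tuple {R : realType} (n : nat) :
    {sigma_finite_measure set (n.-tuple R) -> \bar R} :=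
  match n with
  | 0 => dirac [tuple]
  | n'.+1 => lebesgue_step (lebesgue_tuple n')
  end.

Section definitions.
Context {R : realType} {n : nat}.

Definition col_of_tuple (t : n.-tuple R) : 'cV[R]_n := \col_i tnth t i.

(* Integrability and integral over R^n with respect to Lebesgue measure. *)
Definition integrable_Rn (g : 'cV[R]_n -> R) : Prop :=
  (lebesgue_tuple n).-integrable setT
    (fun t : n.-tuple R => (g (col_of_tuple t))%:E).

Definition integral_Rn (g : 'cV[R]_n -> R) : R :=
  \int[lebesgue_tuple n]_t g (col_of_tuple t).

(* The library norm [`|x|] on vectors is the sup norm. *)
Definition enorm (x : 'cV[R]_n) : R := Num.sqrt (\sum_i x i 0 ^+ 2).

Definition Sym2 : set 'M[R]_n := [set A | A^T = A].

Definition psd (P : 'M[R]_n) : Prop :=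
  Sym2 P /\ forall x : 'cV[R]_n, 0 <= (x^T *m P *m x) 0 0.

Definition cone_subequation (F : set 'M[R]_n) : Prop :=
  [/\ F `<=` Sym2,
      closed F,
      forall A P, F A -> psd P -> F (A + P) &
      forall (t : R) A, 0 <= t -> F A -> F (t *: A)].

(* Boundary relative to Sym^2(R^n), not to the space of all matrices. *)
Definition boundary_Sym2 (F : set 'M[R]_n) : set 'M[R]_n :=
  closure F `&` closure (Sym2 `\` F).

Definition orthogonal_subgroup (G : set 'M[R]_n) : Prop :=
  [/\ forall g, G g -> g^T *m g = 1%:M,
      G 1%:M,
      forall g h, G g -> G h -> G (g *m h) &
      forall g, G g -> G (invmx g)].

Definition sphere_transitive (G : set 'M[R]_n) : Prop :=
  forall x y : 'cV[R]_n, enorm x = 1 -> enorm y = 1 ->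
    exists2 g, G g & g *m x = y.

Definition set_invariant (G F : set 'M[R]_n) : Prop :=
  forall g A, G g -> F A -> F (g *m A *m g^T).

Definition fun_invariant (G F : set 'M[R]_n) (f : 'M[R]_n -> R) : Prop :=
  forall g A, G g -> F A -> f (g *m A *m g^T) = f A.

Definition degenerate_elliptic (F : set 'M[R]_n) (f : 'M[R]_n -> R) : Prop :=
  forall A P, F A -> psd P -> f A <= f (A + P).

Definition homogeneous (F : set 'M[R]_n) (f : 'M[R]_n -> R) (m : R) : Prop :=
  forall (t : R) A, 0 < t -> F A -> f (t *: A) = t `^ m * f A.

Definition compatible (F : set 'M[R]_n) (f : 'M[R]_n -> R) : Prop :=
  boundary_Sym2 F = [set A | F A /\ f A = 0].

(* C^k on an open set of a finite-dimensional space: all iterated directional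
   derivatives of order at most k exist and are continuous. *)
Fixpoint Ck_on (k : nat) (U : set 'M[R]_n) (g : 'M[R]_n -> R) : Prop :=
  (forall A, U A -> {for A, continuous g}) /\
  match k with
  | 0 => True
  | k'.+1 => forall V : 'M[R]_n,
      (forall A, U A -> derivable g A V) /\ Ck_on k' U ('D_V g)
  end.

(* Smooth up to the boundary: near each point of F, boundary points included,
   f is the restriction to F of a C^infinity function. *)
Definition smooth_on (F : set 'M[R]_n) (f : 'M[R]_n -> R) : Prop :=
  forall A, F A -> exists U : set 'M[R]_n, exists g : 'M[R]_n -> R,
    [/\ open U, U A, forall k, Ck_on k U g & forall B, F B -> U B -> g B = f B].

(* Orthogonal projections onto the line R e and onto its complement. *)
Definition proj_line (e : 'cV[R]_n) : 'M[R]_n :=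
  (enorm e ^+ 2)^-1 *: (e *m e^T).

Definition proj_perp (e : 'cV[R]_n) : 'M[R]_n := 1%:M - proj_line e.

Definition riesz_char (F : set 'M[R]_n) (e : 'cV[R]_n) : \bar R :=
  ereal_sup [set q%:E | q in
    [set q : R | F (proj_perp e - (q - 1) *: proj_line e)]].

Definition riesz_profile (p t : R) : R :=
  if p < 2 then (2 - p)^-1 * t `^ (2 - p)
  else if p == 2 then ln t
  else - ((p - 2)^-1 * t `^ (- (p - 2))).

Definition riesz_kernel_eps (p eps : R) (x : 'cV[R]_n) : R :=
  riesz_profile p (Num.sqrt (enorm x ^+ 2 + eps ^+ 2)).

Definition hessian (u : 'cV[R]_n -> R) (x : 'cV[R]_n) : 'M[R]_n :=
  \matrix_(i, j) 'D_(delta_mx i 0) ('D_(delta_mx j 0) u) x.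

(* Weak convergence mu_eps -> c delta_0 as eps decreases to 0, for the measures
   with densities [rho eps], tested on bounded continuous functions. *)
Definition weak_cvg_delta (rho : R -> 'cV[R]_n -> R) (c : R) : Prop :=
  forall psi : 'cV[R]_n -> R,
    continuous psi -> (exists M : R, forall x, `|psi x| <= M) ->
    integral_Rn (fun x => psi x * rho eps x) @[eps --> 0^'+] --> c * psi 0.

End definitions.
Arguments Sym2 R n : clear implicits.

(* Main.v *)
(* Writing q = |x|^2 + eps^2, one computes
     D^2 K_eps(x) = q^(-p/2) (I - (p/q) x x^T),
   which by transitivity of G is conjugate to q^(-p/2) M(p |x|^2 / q), where
   M(a) = I - a P_e.  Homogeneity of f then gives the scaling identity, and
   evaluating it at x = 0 forces m p alpha = n.  The ray M meets F exactly for
   a <= p, with M(p) on the boundary, so f(M(p)) = 0; for 0 <= a < p the matrix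
   M(a) is a multiple of M(p) plus a positive definite matrix, hence is interior
   and f(M(a)) > 0.  Ellipticity makes phi nonincreasing.  One-sided smoothness
   of f at M(p) gives f(M(a)) = O(p - a), i.e. the extra decay |x|^(-2 alpha)
   beyond the critical |x|^(-n), whence integrability of phi.  Weak convergence
   follows by rescaling and dominated convergence. *)
Require Import Defs.
From mathcomp Require Import all_boot all_order all_algebra.
From mathcomp Require Import all_classical all_reals all_analysis.
From mathcomp Require Import measurable_realfun.
From mathcomp Require Import ring lra.
Import Order.TTheory GRing.Theory Num.Theory numFieldNormedType.Exports.
Local Open Scope classical_set_scope.
Local Open Scope ring_scope.

(** * The Hessian of the regularized Riesz kernel *)

Section hessian_riesz_kernel.
Local Set Implicit Arguments.
Local Unset Strict Implicit.
Context {R : realType} {n : nat}.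
Implicit Types (x : 'cV[R]_n).

Lemma enorm_sqr x : enorm x ^+ 2 = \sum_i x i 0 ^+ 2.
Proof. by rewrite /enorm sqr_sqrtr// sumr_ge0// => i _; exact: sqr_ge0. Qed.

Lemma enorm_ge0 x : 0 <= enorm x.
Proof. exact: sqrtr_ge0. Qed.

(** Both sides have the same difference quotients, so one-variable rules apply to partial
    derivatives. *)
Lemma is_derive_line (V : normedModType R) (f : V -> R) (x v : V) (d : R) :
  is_derive (0 : R) 1 (fun h : R => f (h *: v + x)) d -> is_derive x v f d.
Proof.
have E : (fun h : R => h^-1 *: (((fun h : R => f (h *: v + x)) \o shift 0) (h *: (1 : R))
      - f (0 *: v + x))) = (fun h : R => h^-1 *: ((f \o shift x) (h *: v) - f x)).
  by apply/funext => h /=; rewrite addr0 scale0r add0r scaler1.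
case=> + <-; rewrite /derivable /derive /= E => dh.
by split.
Qed.

Lemma enorm_sqr_line x (i : 'I_n) (h : R) :
  enorm (h *: delta_mx i 0 + x) ^+ 2 = enorm x ^+ 2 + 2 * x i 0 * h + h ^+ 2.
Proof.
rewrite !enorm_sqr (bigD1 i)//= [in RHS](bigD1 i)//= !mxE !eqxx/=.
rewrite (eq_bigr (fun j => x j 0 ^+ 2)); last first.
  by move=> j ji; rewrite !mxE (negbTE ji)/= mulr0 add0r.
by ring.
Qed.

(** The constants in [riesz_profile] give k'(t) = t^(1-p) in all three cases; in the variable q =
    t^2 this becomes a single formula. *)
Lemma is_derive_riesz_profile_sqrt (p q : R) : 0 < q ->
  is_derive q 1 (fun q => riesz_profile p (Num.sqrt q)) (2^-1 * q `^ (- (p / 2))).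
Proof.
move=> q0.
have qpos : \near q, 0 < q by exact: lt_nbhsr.
have [p2|p2] := eqVneq p 2.
  have <- : 2^-1 *: q^-1 = 2^-1 * q `^ (- (p / 2)) :> R.
    by rewrite p2 divff// powR_inv1// ltW.
  apply: (@near_eq_is_derive _ _ _ (2^-1 \*: (@ln R))).
    near=> t; rewrite /riesz_profile p2 ltxx eqxx -powR12_sqrt ?ln_powR//.
    by apply/ltW; near: t.
  by apply: is_deriveZ; exact: is_derive1_ln.
have p20 : 2 - p != 0 by rewrite subr_eq0 eq_sym.
apply: (@near_eq_is_derive _ _ _ (fun t : R => (2 - p)^-1 *: t `^ ((2 - p) / 2))).
  near=> t; have t0 : 0 <= t by apply/ltW; near: t.
  rewrite /riesz_profile -powR12_sqrt// -!powRrM (negbTE p2) /= [_ / 2]mulrC.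
  by case: ifPn => // _; rewrite opprB -mulNr -invrN opprB.
apply: is_derive_eq; first exact: is_deriveZ (is_derive1_powR _ q0).
have -> : (2 - p) / 2 - 1 = - (p / 2) by field.
by rewrite /GRing.scale/= mulrA; congr (_ * _); rewrite mulrA mulVf// mul1r.
Unshelve. all: by end_near. Qed.

Lemma is_derive_quadratic (a b : R) :
  is_derive (0 : R) 1 (fun h : R => a + b * h + h ^+ 2) b.
Proof.
by apply: is_derive_eq; rewrite /GRing.scale/=; ring.
Qed.

Lemma is_derive_comp_sqnorm_line (Phi : R -> R) (eps d : R) x (i : 'I_n) :
  is_derive (enorm x ^+ 2 + eps ^+ 2) 1 Phi d ->
  is_derive x (delta_mx i 0) (fun y : 'cV[R]_n => Phi (enorm y ^+ 2 + eps ^+ 2))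
    (d * (2 * x i 0)).
Proof.
move=> dPhi; apply: is_derive_line.
rewrite (_ : (fun _ => _) = Phi \o
    (fun h : R => enorm x ^+ 2 + eps ^+ 2 + 2 * x i 0 * h + h ^+ 2)); last first.
  by apply/funext => h/=; rewrite enorm_sqr_line; congr Phi; ring.
apply: is_derive1_comp; last exact: is_derive_quadratic.
by rewrite mulr0 expr0n/= !addr0.
Qed.

(** The gradient is q^(-p/2) y; differentiating this product gives the identity term and, from the
    power, the rank-one term. *)
Lemma hessian_riesz_kernel_eps (p eps : R) x : 0 < eps ->
  let q := enorm x ^+ 2 + eps ^+ 2 in
  hessian (riesz_kernel_eps p eps) x =
    q `^ (- (p / 2)) *: (1%:M - (p / q) *: (x *m x^T)).
Proof.
move=> eps0 q.
have qpos (y : 'cV[R]_n) : 0 < enorm y ^+ 2 + eps ^+ 2 :> R.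
  by rewrite ltr_wpDl ?sqr_ge0// exprn_gt0.
have q0 : 0 < q by exact: qpos.
have qn0 : q != 0 by rewrite gt_eqF.
have grad j : 'D_(delta_mx j 0) (riesz_kernel_eps p eps) = fun y : 'cV[R]_n =>
    (enorm y ^+ 2 + eps ^+ 2) `^ (- (p / 2)) * y j 0.
  apply/funext => y.
  have := is_derive_comp_sqnorm_line j (is_derive_riesz_profile_sqrt p (qpos y)).
  by move=> /(@derive_val _ _ _ _ _ _ _) ->; field.
apply/matrixP => i j; rewrite !mxE grad big_ord1 !mxE.
have dq := is_derive_comp_sqnorm_line i (is_derive1_powR (- (p / 2)) (qpos x)).
have dj : is_derive x (delta_mx i 0) (fun y : 'cV[R]_n => y j 0) (i == j)%:R.
  apply: is_derive_line.
  rewrite (_ : (fun _ => _) = fun h : R => (i == j)%:R * h + x j 0); last first.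
    by apply/funext => h; rewrite !mxE eqxx andbT mulrC eq_sym.
  by apply: is_derive_eq; rewrite /GRing.scale/= mulr1 addr0.
have /(@derive_val _ _ _ _ _ _ _) -> := is_deriveM dq dj.
rewrite -/q /GRing.scale/= powRB; last by rewrite qn0 implybT.
rewrite powRr1 ?ltW//.
by field.
Qed.
End hessian_riesz_kernel.

(** * The ray I - a P_e in the subequation *)

Section psd_theory.
Local Set Implicit Arguments.
Local Unset Strict Implicit.
Context {R : realType} {n : nat}.
Implicit Types (x u : 'cV[R]_n) (A B P Q : 'M[R]_n).

Lemma Sym2D A B : Sym2 R n A -> Sym2 R n B -> Sym2 R n (A + B).
Proof. by rewrite /Sym2/= => sA sB; rewrite linearD/= sA sB. Qed.

Lemma Sym2Z (c : R) A : Sym2 R n A -> Sym2 R n (c *: A).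
Proof. by rewrite /Sym2/= => sA; rewrite linearZ/= sA. Qed.

Lemma Sym2_scalar (c : R) : Sym2 R n c%:M.
Proof. exact: tr_scalar_mx. Qed.

Lemma Sym2_outer u : Sym2 R n (u *m u^T).
Proof. by rewrite /Sym2/= trmx_mul trmxK. Qed.

Lemma sqnormE x : (x^T *m x) 0 0 = enorm x ^+ 2.
Proof.
by rewrite enorm_sqr mxE; apply: eq_bigr => i _; rewrite mxE expr2.
Qed.

Lemma qformE A x : (x^T *m A *m x) 0 0 = \sum_i \sum_j A i j * (x i 0 * x j 0).
Proof.
rewrite -mulmxA mxE; apply: eq_bigr => i _; rewrite !mxE big_distrr/=.
by apply: eq_bigr => j _; ring.
Qed.

Lemma psdD P Q : psd P -> psd Q -> psd (P + Q).
Proof.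
move=> [sP P0] [sQ Q0]; split; first exact: Sym2D.
by move=> x; rewrite mulmxDr mulmxDl mxE addr_ge0.
Qed.

Lemma psdZ (c : R) P : 0 <= c -> psd P -> psd (c *: P).
Proof.
move=> c0 [sP P0]; split; first exact: Sym2Z.
by move=> x; rewrite -scalemxAr -scalemxAl mxE mulr_ge0.
Qed.

Lemma psd1 : psd (1%:M : 'M[R]_n).
Proof.
split; first exact: Sym2_scalar.
by move=> x; rewrite mulmx1 sqnormE sqr_ge0.
Qed.

Lemma psd_outer u : psd (u *m u^T).
Proof.
split; first exact: Sym2_outer.
move=> x; rewrite mulmxA -mulmxA mxE big_ord1.
rewrite -[u^T *m x]trmxK trmx_mul trmxK [_^T _ _]mxE -expr2.
exact: sqr_ge0.
Qed.

(** Entries of size at most c/n give |x^T E x| <= c |x|^2, since |x_i x_j| <= (x_i^2 + x_j^2)/2; the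
    slack c I in [Q] absorbs this. *)
Lemma psd_add_small (c : R) (Q E : 'M[R]_n) : psd (Q - c%:M) -> Sym2 R n E ->
  (forall i j, `|E i j| * n%:R <= c) -> psd (Q + E).
Proof.
move=> [sQ Q0] sE Ec; split.
  by apply: Sym2D => //; rewrite -[Q](subrK c%:M); exact/Sym2D/Sym2_scalar.
move=> x; rewrite -[Q](subrK c%:M) -addrA mulmxDr mulmxDl mxE addr_ge0//.
rewrite mulmxDr mulmxDl mxE mul_mx_scalar -scalemxAl mxE sqnormE qformE.
rewrite -lerBlDl sub0r enorm_sqr.
have [n0|n0] := posnP n.
  have noI (i : 'I_n) : False by have := ltn_ord i; rewrite {2}n0.
  by rewrite !big1 ?mulr0 ?oppr0// => i; case: (noI i).
have nR : 0 < n%:R :> R by rewrite ltr0n.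
(* Spreading -c |x|^2 over the n^2 index pairs allows a comparison term by term. *)
have -> : - (c * \sum_i x i 0 ^+ 2) =
    \sum_i \sum_j - (c / n%:R) * ((x i 0 ^+ 2 + x j 0 ^+ 2) / 2).
  have S : \sum_i \sum_j (x i 0 ^+ 2 + x j 0 ^+ 2) =
      2 * n%:R * \sum_i x i 0 ^+ 2 :> R.
    under eq_bigr do rewrite big_split/= sumr_const card_ord.
    rewrite big_split/= sumr_const card_ord -sumrMnl.
    by rewrite -mulr2n -mulr_natr sumrMnl -mulr_natr; ring.
  transitivity (- (c / n%:R) / 2 * \sum_i \sum_j (x i 0 ^+ 2 + x j 0 ^+ 2)).
    by rewrite S; field; rewrite gt_eqF.
  rewrite mulr_sumr; apply: eq_bigr => i _; rewrite mulr_sumr.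
  by apply: eq_bigr => j _; ring.
apply: ler_sum => i _; apply: ler_sum => j _.
have Eij : `|E i j| <= c / n%:R by rewrite ler_pdivlMr.
have : `|E i j * (x i 0 * x j 0)| <= c / n%:R * ((x i 0 ^+ 2 + x j 0 ^+ 2) / 2).
  rewrite normrM; apply: ler_pM => //.
  have := sqr_ge0 (x i 0 + x j 0); have := sqr_ge0 (x i 0 - x j 0).
  by rewrite ler_norml => ? ?; apply/andP; split; nra.
by rewrite mulNr ler_norml => /andP[].
Qed.

End psd_theory.

(** * Membership in F and values of f along the ray *)

Section riesz_ray_theory.
Local Set Implicit Arguments.
Local Unset Strict Implicit.
Context {R : realType} {n : nat}.
Variables (F : set 'M[R]_n) (e : 'cV[R]_n) (p : R).
Hypothesis hF : cone_subequation F.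
Hypothesis he : e != 0.
Hypothesis hp : riesz_char F e = p%:E.

(** Parametrized as in [riesz_char], so that the ray leaves [F] at a = p; decreasing [a] adds a
    nonnegative multiple of P_e. *)
Definition riesz_ray (a : R) : 'M[R]_n := 1%:M - a *: proj_line e.

Lemma rayE (q : R) : proj_perp e - (q - 1) *: proj_line e = riesz_ray q.
Proof. by rewrite /riesz_ray /proj_perp scalerBl scale1r opprB addrA subrK. Qed.

Lemma enorm_gt0 : 0 < enorm e.
Proof.
rewrite lt_neqAle enorm_ge0 andbT eq_sym -sqrf_eq0 enorm_sqr.
rewrite psumr_eq0 => [|i _]; last exact: sqr_ge0.
apply: contra he => /allP e0; apply/eqP/matrixP => i j; rewrite ord1 mxE.
by have := e0 i (mem_index_enum i); rewrite sqrf_eq0 => /eqP.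
Qed.

Lemma psd_proj_line : psd (proj_line e).
Proof. by apply: psdZ; [rewrite invr_ge0 sqr_ge0|exact: psd_outer]. Qed.

Lemma Sym2_ray (a : R) : Sym2 R n (riesz_ray a).
Proof.
rewrite /riesz_ray -scaleNr; apply: Sym2D; first exact: Sym2_scalar.
by apply: Sym2Z; exact: psd_proj_line.1.
Qed.

Lemma ray_psd (a b : R) : b <= a -> psd ((a - b) *: proj_line e).
Proof. by move=> ab; apply: psdZ psd_proj_line; rewrite subr_ge0. Qed.

Lemma raydE (a b : R) : riesz_ray b = riesz_ray a + (a - b) *: proj_line e.
Proof. by rewrite /riesz_ray scalerBl addrA subrK. Qed.

Lemma ray_continuous : continuous riesz_ray.
Proof.
move=> a; apply: cvgB; first exact: cvg_cst.
by apply: cvgZr_tmp; exact: cvg_id.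
Qed.

(** With s = -1 the endpoint is approached inside [F], with s = 1 outside it. *)
Lemma cvg_ray (s : R) : riesz_ray (p + s * k.+1%:R^-1) @[k --> \oo] --> riesz_ray p.
Proof.
apply: continuous_cvg; first exact: ray_continuous.
rewrite -[X in _ --> X]addr0; apply: cvgD; first exact: cvg_cst.
rewrite -(mulr0 s); apply: cvgM; first exact: cvg_cst.
exact: cvg_harmonic.
Qed.

Lemma ray_mem_le (a : R) : F (riesz_ray a) -> a <= p.
Proof.
by rewrite -rayE -lee_fin -hp => Fa; apply: ereal_sup_ubound; exists a.
Qed.

(** Some admissible q exceeds [a], and passing from q to [a] adds (q - a) P_e >= 0. *)
Lemma ray_mem_lt (a : R) : a < p -> F (riesz_ray a).
Proof.
rewrite -lte_fin -hp => /ereal_sup_gt[_ [q Fq <-]]; rewrite lte_fin => aq.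
rewrite (raydE q); case: hF => _ _ addF _; apply: addF.
  by rewrite -rayE.
exact/ray_psd/ltW.
Qed.

Lemma ray_mem_end : F (riesz_ray p).
Proof.
have [_ clF _ _] := hF.
apply: (closed_cvg F clF _ _ (@cvg_ray (-1))).
near=> k; apply: ray_mem_lt.
by rewrite mulN1r gtrDl oppr_lt0 invr_gt0 ltr0n.
Unshelve. all: by end_near. Qed.

Lemma ray_mem (a : R) : a <= p -> F (riesz_ray a).
Proof. by rewrite le_eqVlt => /predU1P[->|/ray_mem_lt//]; exact: ray_mem_end. Qed.

Lemma ray_end_boundary : boundary_Sym2 F (riesz_ray p).
Proof.
split; first by apply: subset_closure; exact: ray_mem_end.
apply: (closed_cvg _ (@closed_closure _ _) _ _ (@cvg_ray 1)).
near=> k; apply: subset_closure; split; first exact: Sym2_ray.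
move=> /ray_mem_le; apply/negP.
by rewrite -ltNge mul1r ltrDl invr_gt0 ltr0n.
Unshelve. all: by end_near. Qed.

(** Below the endpoint the ray exceeds a multiple of its boundary matrix by a uniformly positive
    amount; both interiority and positivity of [f] rest on this. *)
Lemma ray_psd_gap (a : R) : 0 <= a -> a < p -> exists c d : R,
  [/\ 0 < c, 0 < d & psd (riesz_ray a - c *: riesz_ray p - d%:M)].
Proof.
move=> a0 ap; have p0 : 0 < p by exact: le_lt_trans ap.
(* Here c p is the midpoint of a and p, and a < p gives c < 1; d = 1 - c cancels the identity and
   leaves ((a + p)/2 - a) P_e >= 0. *)
exists ((a + p) / (2 * p)), (1 - (a + p) / (2 * p)); split.
- by rewrite divr_gt0 ?mulr_gt0// ltr_wpDl.
- by rewrite subr_gt0 ltr_pdivrMr ?mulr_gt0//; nra.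
- rewrite (_ : _ - _ = ((a + p) / 2 - a) *: proj_line e).
    by apply: ray_psd; lra.
  apply/matrixP => i j; rewrite !mxE; case: (i == j) => /=; rewrite ?mulr1n ?mulr0n.
    by move: (_ * \sum_(_ < _) _) => t; field; rewrite gt_eqF.
  by move: (_ * \sum_(_ < _) _) => t; field; rewrite gt_eqF.
Qed.

(** Every symmetric matrix close to [riesz_ray a] is still a multiple of [riesz_ray p] plus a
    positive semidefinite matrix, hence in [F]. *)
Lemma ray_interior (a : R) : 0 <= a -> a < p -> ~ boundary_Sym2 F (riesz_ray a).
Proof.
move=> a0 ap [_]; have [c [d [c0 d0 psdQ]]] := ray_psd_gap a0 ap.
(* For n = 0 the radius d/n degenerates, but there is only one matrix. *)
have [n0|n0] := posnP n.
  have FS B : F B.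
    rewrite (_ : B = riesz_ray a); first exact/ray_mem/ltW.
    by apply/matrixP => i; exfalso; have := ltn_ord i; rewrite {2}n0.
  by move=> /(_ setT filterT)[B [[_ /(_ (FS B))]]].
have dn : 0 < d / n%:R by rewrite divr_gt0// ltr0n.
(* The matrix norm is the sup norm of the entries, so radius d/n meets the bound in
   [psd_add_small]. *)
move=> /(_ _ (nbhsx_ballx (riesz_ray a) _ dn))[B [[SB +] aB]]; apply.
rewrite (_ : B = c *: riesz_ray p +
    ((riesz_ray a - c *: riesz_ray p) + (B - riesz_ray a))); last first.
  by rewrite addrA [X in X + _]addrC subrK addrC subrK.
case: hF => _ _ addF scaleF; apply: addF; first exact/scaleF/ray_mem_end/ltW.
apply: psd_add_small psdQ _ _.
  by rewrite -scaleN1r; exact/Sym2D/Sym2Z/Sym2_ray.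
move=> i j; rewrite -ler_pdivlMr ?ltr0n// ltW//.
by case: aB => _ /(_ i j); rewrite /ball/= !mxE distrC.
Qed.

Context (f : 'M[R]_n -> R) (m : R).
Hypothesis hfell : degenerate_elliptic F f.
Hypothesis hfhom : homogeneous F f m.
Hypothesis hfcompat : compatible F f.
Hypothesis hfsmooth : smooth_on F f.

Lemma f_ray_end : f (riesz_ray p) = 0.
Proof. by have := ray_end_boundary; rewrite hfcompat => -[]. Qed.

Lemma f_ray_le (a b : R) : b <= a -> a <= p -> f (riesz_ray a) <= f (riesz_ray b).
Proof.
move=> ba ap; rewrite (raydE a b); apply: hfell; first exact: ray_mem.
exact: ray_psd.
Qed.

(** Ellipticity bounds [f] below by its value at a multiple of [riesz_ray p], which is 0 by
    homogeneity; equality would put the matrix on the boundary. *)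
Lemma f_ray_gt0 (a : R) : 0 <= a -> a < p -> 0 < f (riesz_ray a).
Proof.
move=> a0 ap; have [c [d [c0 d0 psdQ]]] := ray_psd_gap a0 ap.
have psdQ' : psd (riesz_ray a - c *: riesz_ray p).
  rewrite -[_ - _](subrK (d%:M)); apply: psdD => //.
  by rewrite -scalemx1; apply: psdZ psd1; exact: ltW.
rewrite lt_neqAle; apply/andP; split.
  rewrite eq_sym; apply/eqP => fa0; apply: (ray_interior a0 ap).
  by rewrite hfcompat; split => //; exact/ray_mem/ltW.
have -> : 0 = f (c *: riesz_ray p).
  by rewrite hfhom ?f_ray_end ?mulr0//; exact: ray_mem_end.
rewrite -[riesz_ray a](subrK (c *: riesz_ray p)) addrC; apply: hfell => //.
by case: hF => _ _ _ scaleF; exact/scaleF/ray_mem_end/ltW.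
Qed.

(** Near the endpoint [f] agrees on [F] with a differentiable function vanishing there; away from
    it, monotonicity along the ray suffices. *)
Lemma f_ray_linear_bound : 0 < p -> exists2 C : R, 0 < C &
  forall a : R, 0 <= a -> a <= p -> f (riesz_ray a) <= C * (p - a).
Proof.
move=> p0; have [U [g [oU Up sg gf]]] := hfsmooth ray_mem_end.
have [_ /(_ (proj_line e))[/(_ _ Up) dg _]] := sg 1.
have Ug : \forall h \near (0 : R), U (riesz_ray (p - h)).
  have : riesz_ray (p - h) @[h --> (0 : R)] --> riesz_ray p.
    apply: continuous_cvg; first exact: ray_continuous.
    rewrite -[X in _ --> X]subr0; apply: cvgB; [exact: cvg_cst|exact: cvg_id].
  by apply; exact: open_nbhs_nbhs.
set D : R := 'D_(proj_line e) g (riesz_ray p).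
(* The derivative is two-sided and the ray leaves [F] for h < 0, so the quotients are those of the
   extension [g]. *)
have quot : \forall h \near (0 : R)^',
    `|h^-1 *: (g (riesz_ray (p - h)) - g (riesz_ray p))| <= `|D| + 1.
  have := cvgr_norm_le _ dg (`|D| + 1).
  rewrite ltrDl ltr01 => /(_ _ isT); apply: filterS => h /=.
  by rewrite (raydE p (p - h)) subKr [riesz_ray p + _]addrC.
have [d d0 dP] : exists2 d : R, 0 < d & forall h, 0 < h -> h < d ->
    U (riesz_ray (p - h)) /\
    `|h^-1 *: (g (riesz_ray (p - h)) - g (riesz_ray p))| <= `|D| + 1.
  have : \forall h \near (0 : R), U (riesz_ray (p - h)) /\ (h != 0 ->
      `|h^-1 *: (g (riesz_ray (p - h)) - g (riesz_ray p))| <= `|D| + 1).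
    exact: filterI Ug quot.
  move=> /nbhs_ballP[d /= d0 dP].
  exists d => // h h0 hd; have [|? /(_ _)] := dP h.
    by rewrite /ball/= sub0r normrN gtr0_norm.
  by move=> H; split => //; apply: H; rewrite gt_eqF.
have f0 : 0 < f (riesz_ray 0) by exact: f_ray_gt0.
(* The terms |D| + 1 serve p - a < d; for p - a >= d the last term times p - a already dominates the
   value of [f] at parameter 0. *)
exists (`|D| + 1 + f (riesz_ray 0) / d).
  by rewrite ltr_wpDl// ?divr_gt0// addr_ge0.
move=> a a0; rewrite le_eqVlt => /predU1P[->|ap].
  by rewrite f_ray_end subrr mulr0.
have h0 : 0 < p - a by rewrite subr_gt0.
have [hd|hd] := ltP (p - a) d.
  have [] := dP _ h0 hd; rewrite subKr => Ua.
  rewrite gf ?gf//; [|exact: ray_mem_end|exact/ray_mem/ltW].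
  rewrite f_ray_end subr0 normrZ gtr0_norm ?invr_gt0//.
  rewrite ler_pdivrMl// => /(le_trans (ler_norm _))/le_trans; apply.
  by rewrite mulrC ler_wpM2r ?(ltW h0)// lerDl divr_ge0 ?(ltW f0) ?(ltW d0).
apply: le_trans (f_ray_le a0 (ltW ap)) _.
rewrite mulrDl; apply: ler_wpDl; first by rewrite mulr_ge0 ?(ltW h0) ?addr_ge0.
by rewrite -mulrA ler_peMr ?(ltW f0)// mulrC ler_pdivlMr// mul1r.
Qed.

End riesz_ray_theory.

(** * Lebesgue measure on tuples *)

Section lebesgue_tuple_theory.
Local Set Implicit Arguments.
Local Unset Strict Implicit.
Context {R : realType}.

(** The measure is the image of a product measure, so Tonelli applies; this drives the inductions on
    the dimension. *)
Lemma ge0_integral_lebesgue_tupleS n (g : n.+1.-tuple R -> \bar R) :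
  measurable_fun setT g -> (forall t, 0 <= g t)%E ->
  (\int[lebesgue_tuple n.+1]_t g t =
   \int[lebesgue_measure]_x \int[lebesgue_tuple n]_t g [the n.+1.-tuple R of x :: t])%E.
Proof.
move=> mg g0.
transitivity (\int[pushforward (lebesgue_measure \x lebesgue_tuple n)%E
    (@tuple_consp R n)]_t g t)%E; first by [].
rewrite ge0_integral_pushforward//; last exact: measurable_tuple_consp.
rewrite preimage_setT fubini_tonelli1//; last by move=> ?; exact: g0.
by apply: measurableT_comp => //; exact: measurable_tuple_consp.
Qed.

Lemma measurable_integral_lebesgue_tuple_cons n (g : n.+1.-tuple R -> \bar R) :
  measurable_fun setT g -> (forall t, 0 <= g t)%E ->
  measurable_fun setT (fun x : measurableTypeR R =>
    \int[lebesgue_tuple n]_t g [the n.+1.-tuple R of x :: t])%E.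
Proof.
move=> mg g0.
apply: (@measurable_fun_fubini_tonelli_F _ _ (measurableTypeR R) (n.-tuple R) R
  (lebesgue_tuple n) (g \o @tuple_consp R n)) => //=.
by apply: measurableT_comp => //; exact: measurable_tuple_consp.
Qed.

(** The image of Lebesgue measure under multiplication by [a], times [a], gives half-open intervals
    their length; uniqueness identifies it. *)
Lemma ge0_integral_lebesgue_scale (a : R) (g : measurableTypeR R -> \bar R) : 0 < a ->
  measurable_fun [set: measurableTypeR R] g -> (forall t, 0 <= g t)%E ->
  (\int[lebesgue_measure]_x g x =
   a%:E * \int[lebesgue_measure]_x g (a * x)%R)%E.
Proof.
move=> a0 mg g0.
have ma : measurable_fun setT (fun x : measurableTypeR R => a * x : measurableTypeR R).
  exact: measurable_funM.
pose mu : {measure set (measurableTypeR R) -> \bar R} :=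
  mscale (NngNum (ltW a0))
    (measure_function_pushforward__canonical__measure_function_Measure
      (@lebesgue_measure R) ma).
have lmu A : measurable A -> lebesgue_measure A = mu A.
  apply: lebesgue_measure_unique => _ [[x y] _ <-].
  rewrite /mu/= /mscale/= /pushforward/=.
  rewrite (_ : (fun _ => _) @^-1` _ = `]x / a, y / a]%classic); last first.
    apply/seteqP; split => z; rewrite /= !in_itv/= ltr_pdivrMr// ler_pdivlMr//;
      by rewrite mulrC.
  rewrite !lebesgue_measure_itv/= !lte_fin ltr_pM2r ?invr_gt0//.
  case: ifPn => _; last by rewrite mule0.
  by rewrite -!EFinB -EFinM -mulrBl mulrC divfK// gt_eqF.
rewrite (@eq_measure_integral _ _ _ _ mu); last by move=> A mA _; exact: lmu.
rewrite ge0_integral_mscale//; congr (_ * _)%E.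
by rewrite ge0_integral_pushforward.
Qed.

Definition scale_tuple n (a : R) (t : n.-tuple R) : n.-tuple R :=
  [tuple of map ( *%R a) t].

Lemma measurable_scale_tuple n (a : R) : measurable_fun setT (@scale_tuple n a).
Proof.
apply/measurable_fun_tnthP => i.
rewrite (_ : _ \o _ = fun t : n.-tuple R => a * tnth t i); last first.
  by apply/funext => t; rewrite /= tnth_map.
by apply: measurable_funM => //; exact: measurable_tnth.
Qed.

(** By induction, each coordinate contributes one factor [a]. *)
Lemma ge0_integral_lebesgue_tuple_scale n (a : R) (g : n.-tuple R -> \bar R) :
  0 < a -> measurable_fun setT g -> (forall t, 0 <= g t)%E ->
  (\int[lebesgue_tuple n]_t g t =
   (a ^+ n)%:E * \int[lebesgue_tuple n]_t g (scale_tuple a t))%E.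
Proof.
move=> a0; elim: n g => [|n IHn] g mg g0.
  rewrite expr0 mul1e; apply: eq_integral => t _.
  by rewrite [t]tuple0 [scale_tuple _ _]tuple0.
have mgs : measurable_fun setT (g \o @scale_tuple n.+1 a).
  by apply: measurableT_comp => //; exact: measurable_scale_tuple.
rewrite !ge0_integral_lebesgue_tupleS//.
rewrite (ge0_integral_lebesgue_scale a0)//; last 2 first.
- exact: measurable_integral_lebesgue_tuple_cons.
- by move=> x; exact: integral_ge0.
rewrite exprS EFinM -muleA; congr (_ * _)%E.
rewrite -ge0_integralZl_EFin ?exprn_ge0 ?ltW//; last 2 first.
- by move=> x _; exact: integral_ge0.
- by apply: (measurable_integral_lebesgue_tuple_cons mgs) => t; exact: g0.
apply: eq_integral => x _; rewrite IHn//; last first.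
  by apply: (measurableT_comp mg); exact: measurable_cons.
by congr (_ * _)%E; apply: eq_integral => t _; congr g; exact: val_inj.
Qed.

(** Each step of the iterated integral splits off the one-dimensional integral of [w]. *)
Lemma integral_lebesgue_tuple_prod_lty n (w : R -> R) :
  measurable_fun setT w -> (forall x, 0 <= w x) ->
  (\int[lebesgue_measure]_x (w x)%:E < +oo)%E ->
  (\int[lebesgue_tuple n]_t (\prod_i w (tnth t i))%:E < +oo)%E.
Proof.
move=> mw w0 wfin; elim: n => [|n IHn].
  under eq_integral do rewrite big_ord0.
  by rewrite integral_dirac// mule1 diracT ltry.
have mprod k : measurable_fun setT (fun t : k.-tuple R => (\prod_i w (tnth t i))%:E).
  apply/measurable_EFinP; apply: measurable_prod => i _.
  by apply: measurableT_comp => //; exact: measurable_tnth.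
rewrite ge0_integral_lebesgue_tupleS//; last first.
  by move=> t; rewrite lee_fin prodr_ge0.
rewrite (eq_integral (fun x : measurableTypeR R => (w x)%:E *
    \int[lebesgue_tuple n]_t (\prod_i w (tnth t i))%:E)%E); last first.
  move=> x _; rewrite -ge0_integralZl_EFin//; last 2 first.
  - by move=> t _; rewrite lee_fin prodr_ge0.
  - exact: mprod.
  apply: eq_integral => t _; rewrite big_ord_recl -EFinM; congr (_ * _)%:E.
  by apply: eq_bigr => i _; rewrite tnthS.
have prod0 : (0 <= \int[lebesgue_tuple n]_t (\prod_i w (tnth t i))%:E)%E.
  by apply: integral_ge0 => t _; rewrite lee_fin prodr_ge0.
rewrite ge0_integralZr//; last 2 first.
- exact/measurable_EFinP.
- by move=> x _; rewrite lee_fin.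
have w0i : (0 <= \int[@lebesgue_measure R]_x (w x)%:E)%E.
  by apply: integral_ge0 => x _; rewrite lee_fin.
by apply: lte_mul_pinfty; rewrite ?ge0_fin_numE.
Qed.

(** Ensures that an everywhere positive function cannot have integral 0. *)
Lemma lebesgue_tuple_setT_gt0 n : (0 < lebesgue_tuple n [set: n.-tuple R])%E.
Proof.
elim: n => [|n IHn]; first by rewrite /= diracT lte_fin.
rewrite /= /lebesgue_step /pushforward preimage_setT -setXTT product_measure1E//.
apply: mule_gt0 => //.
have lT := @lebesgue_measure_itv R `]-oo, +oo[; rewrite set_itvNyy/= in lT.
by rewrite [X in (0 < X)%E]lT lt0y.
Qed.

End lebesgue_tuple_theory.

(** * One-dimensional integrability of powers of 1 + |x| *)

Section power_decay.
Local Set Implicit Arguments.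
Local Unset Strict Implicit.
Context {R : realType}.

Lemma powR_continuous_at (g a : R) : 0 < a -> {for a, continuous (fun x : R => x `^ g)}.
Proof.
move=> a0; apply: differentiable_continuous; apply/derivable1_diffP.
by apply: derivable_powR; rewrite in_itv/= a0.
Qed.

Lemma cvgy_powRN (d : R) : 0 < d -> (1 + x) `^ (- d) @[x --> +oo%R] --> (0 : R).
Proof.
move=> d0; apply/cvgrPdist_le => e e0.
near=> x; have x0 : 0 <= x by near: x; exact: nbhs_pinfty_ge.
rewrite sub0r normrN ger0_norm ?powR_ge0// powRN -[leRHS]invrK.
rewrite lef_pV2 ?posrE ?invr_gt0 ?powR_gt0 ?ltr_wpDr//.
(* The threshold is x >= (1/e)^(1/d), which makes (1 + x)^d at least 1/e. *)
have -> : e^-1 = (e^-1 `^ d^-1) `^ d.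
  by rewrite -powRrM mulVf ?gt_eqF// powRr1// invr_ge0 ltW.
apply: ge0_ler_powR; rewrite ?nnegrE ?powR_ge0 ?addr_ge0 ?(ltW d0)//.
rewrite (@le_trans _ _ x) ?lerDr//.
Unshelve. all: by end_near. Qed.

Lemma continuous_powR_1Dnorm (g : R) : continuous (fun x : R => (1 + `|x|) `^ g).
Proof.
move=> x; apply: (@continuous_comp _ _ _ (fun x : R => 1 + `|x|) (fun y => y `^ g)).
  by apply: cvgD; [exact: cvg_cst|exact: norm_continuous].
by apply: powR_continuous_at; rewrite ltr_wpDr.
Qed.

(** By symmetry this is twice the half-line integral, where -(1 + x)^(1-g)/(g - 1) is an
    antiderivative vanishing at infinity. *)
Lemma integral_powR_1Dnorm_lty (g : R) : 1 < g ->
  (\int[@lebesgue_measure R]_x ((1 + `|x|) `^ (- g))%:E < +oo)%E.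
Proof.
move=> g1; have d0 : 0 < g - 1 by rewrite subr_gt0.
have dF (x : R) : 0 <= x -> is_derive x 1
    (fun x : R => - (g - 1)^-1 *: (1 + x) `^ (- (g - 1))) ((1 + x) `^ (- g)).
  move=> x0; have x1 : 0 < 1 + x by rewrite ltr_wpDr.
  have dp : is_derive (1 + x) 1 (fun y : R => y `^ (- (g - 1)))
      (- (g - 1) * (1 + x) `^ (- (g - 1) - 1)) by exact: is_derive1_powR.
  have d1 : is_derive x 1 (fun x : R => 1 + x) 1.
    by apply: is_derive_eq; rewrite add0r mulr1.
  have := is_deriveZ (- (g - 1)^-1) (is_derive1_comp dp d1).
  rewrite /GRing.scale/= mulr1 mulrA mulrNN mulVf ?gt_eqF// mul1r.
  by have -> : - (g - 1) - 1 = - g by ring.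
rewrite ge0_symfun_integralT; last 3 first.
- by move=> x; exact: powR_ge0.
- exact: continuous_powR_1Dnorm.
- by move=> x /=; rewrite normrN.
rewrite -set_itvcy (@ge0_continuous_FTC2y _ _
  (fun x : R => - (g - 1)^-1 *: (1 + x) `^ (- (g - 1))) _ 0).
- by rewrite -EFinB -EFinM ltry.
- by move=> x _; exact: powR_ge0.
- exact/continuous_subspaceT/continuous_powR_1Dnorm.
- rewrite -[X in _ --> X](mulr0 (- (g - 1)^-1)).
  by apply: cvgM; [exact: cvg_cst|exact: cvgy_powRN].
- by move=> x x0; have [] := dF x (ltW x0).
- apply: cvg_at_right_filter.
  have [/derivable1_diffP/differentiable_continuous + _] := dF 0 (lexx _).
  exact.
- move=> x; rewrite in_itv/= andbT => x0.
  by rewrite derive1E (@derive_val _ _ _ _ _ _ _ (dF x (ltW x0))) ger0_norm// ltW.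
Qed.

End power_decay.

(** * Measurability of continuous functions on tuples *)

Section continuous_measurable.
Local Set Implicit Arguments.
Local Unset Strict Implicit.
Context {R : realType} {n : nat}.

(** An open set is the union of the countably many boxes inside it with rational centre and
    half-width 1/(k+1); each box is measurable coordinatewise. *)
Lemma open_measurable_tuple (U : set 'cV[R]_n) : open U ->
  measurable [set t : n.-tuple R | U (col_of_tuple t)].
Proof.
move=> oU.
pose B (c : 'cV[rat]_n * nat) : set (n.-tuple R) :=
  \bigcap_(i in [set: 'I_n]) ((fun t : n.-tuple R => tnth t i) @^-1`
    ball (ratr (c.1 i 0) : R) c.2.+1%:R^-1).
(* Boxes not contained in [U] become empty, so the union can run over the whole countable index
   type. *)
pose W (c : 'cV[rat]_n * nat) := if `[< B c `<=` [set t | U (col_of_tuple t)] >]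
  then B c else set0.
have mB c : measurable (B c).
  apply: fin_bigcap_measurable => // i _; rewrite -[X in measurable X]setTI.
  by apply: measurable_tnth => //; exact: measurable_ball.
rewrite (_ : [set t | _] = \bigcup_c W c); last first.
  apply/seteqP; split => [t Ut|t [c _]]; last first.
    by rewrite /W; case: asboolP => // + Bt; exact.
  have [r r0 rU] : exists2 r : R, 0 < r & ball (col_of_tuple t) r `<=` U.
    have /nbhs_ballP[r /= r0 rU] : nbhs (col_of_tuple t) U.
      by apply: open_nbhs_nbhs.
    by exists r.
  have [k kr] : exists k : nat, k.+1%:R^-1 < r / 2.
    have r2 : 0 < r / 2 by rewrite divr_gt0.
    by have [k] := ltr_add_invr r2; rewrite add0r; exists k.
  have kp : 0 < k.+1%:R^-1 :> R by rewrite invr_gt0.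
  have q i : {q : rat | ball (ratr q : R) k.+1%:R^-1 (tnth t i)}.
    apply: cid; have [|q] := @rat_in_itvoo R (tnth t i) (tnth t i + k.+1%:R^-1).
      by rewrite ltrDl.
    rewrite in_itv/= => /andP[tq qt]; exists q.
    by rewrite /ball/= gtr0_norm ?subr_gt0// ltrBlDl.
  exists (\col_i sval (q i), k) => //; rewrite /W asboolT.
    by move=> i _ /=; rewrite mxE; exact: (svalP (q i)).
  move=> s Bs; apply: rU; split=> // i j; rewrite !mxE.
  have := Bs i I; have := svalP (q i); rewrite /= mxE.
  rewrite /ball/= => h1 h2.
  rewrite -(subrKA (ratr (sval (q i)))) (le_lt_trans (ler_normD _ _))//.
  by rewrite distrC [ltRHS](splitr r) ltrD// (lt_trans _ kr).
apply: countable_bigcupT_measurable.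
  exact: countableP.
by move=> c; rewrite /W; case: ifPn.
Qed.

Lemma continuous_measurable_tuple (psi : 'cV[R]_n -> R) : continuous psi ->
  measurable_fun setT (fun t : n.-tuple R => psi (col_of_tuple t)).
Proof.
move=> cpsi; apply: (measurability (@RGenOInfty.G R)).
  exact: RGenOInfty.measurableE.
move=> _ [_ [r ->] <-]; rewrite setTI.
apply: (@open_measurable_tuple (psi @^-1` `]r, +oo[)).
by apply: open_comp; [move=> x _; exact: cpsi|exact: interval_open].
Qed.

End continuous_measurable.

(** * Radial approximate delta functions *)

Section change_of_variables.
Local Set Implicit Arguments.
Local Unset Strict Implicit.
Context {R : realType} {n : nat}.

Lemma col_of_tuple_scale (a : R) (t : n.-tuple R) :
  col_of_tuple (scale_tuple a t) = a *: col_of_tuple t.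
Proof. by apply/matrixP => i j; rewrite !mxE tnth_map. Qed.

Lemma enormZ (a : R) (x : 'cV[R]_n) : 0 <= a -> enorm (a *: x) = a * enorm x.
Proof.
move=> a0; rewrite /enorm; under eq_bigr do rewrite mxE exprMn.
by rewrite -mulr_sumr sqrtrM ?sqr_ge0// sqrtr_sqr ger0_norm.
Qed.

(** The nonnegative case is applied to the positive and negative parts; integrability lets a^n be
    factored out of their difference. *)
Lemma integral_Rn_scale (a : R) (h : 'cV[R]_n -> R) : 0 < a ->
  measurable_fun setT (fun t : n.-tuple R => h (col_of_tuple t)) ->
  integrable_Rn (fun x => h (a *: x)) ->
  integral_Rn h = a ^+ n * integral_Rn (fun x => h (a *: x)).
Proof.
move=> a0 mh ih; have an0 : 0 <= a ^+ n by rewrite exprn_ge0// ltW.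
rewrite /integral_Rn /Rintegral -[a ^+ n]/(fine (a ^+ n)%:E).
rewrite -fineM//; last exact: integrable_fin_num.
congr fine; rewrite integralE [in RHS]integralE.
have /measurable_EFinP mEh := mh.
rewrite [X in (X - _ = _)%E](ge0_integral_lebesgue_tuple_scale a0)//; last first.
  exact: measurable_funepos.
rewrite [X in (_ - X = _)%E](ge0_integral_lebesgue_tuple_scale a0)//; last first.
  exact: measurable_funeneg.
pose hs (t : n.-tuple R) := (h (a *: col_of_tuple t))%:E.
rewrite [X in (_ * X - _ = _)%E](_ : _ = \int[lebesgue_tuple n]_t hs^\+%E t)%E;
  last by apply: eq_integral => t _; rewrite !funeposE col_of_tuple_scale.
rewrite [X in (_ - _ * X = _)%E](_ : _ = \int[lebesgue_tuple n]_t hs^\-%E t)%E;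
  last by apply: eq_integral => t _; rewrite !funenegE col_of_tuple_scale.
by rewrite [RHS]muleBr// fin_num_adde_defl// fin_numN integrable_neg_fin_num.
Qed.

End change_of_variables.

(** * Rescalings of a positive nonincreasing profile decaying faster than |x|^(-n) *)

Section radial_approximate_delta.
Local Set Implicit Arguments.
Local Unset Strict Implicit.
Context {R : realType} {n : nat}.
Variables (phi : R -> R) (C alpha : R).
Hypothesis hn : (0 < n)%N.
Hypothesis alpha0 : 0 < alpha.
Hypothesis phi_gt0 : forall r : R, 0 <= r -> 0 < phi r.
Hypothesis phi_ni : forall r s : R, 0 <= r -> r <= s -> phi s <= phi r.
Hypothesis phi_decay : forall r : R, 0 <= r ->
  phi r <= C * (r ^+ 2 + 1) `^ (- (n%:R / 2 + alpha)).

Let mu := @lebesgue_tuple R n.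
Let phi_ (eps : R) (x : 'cV[R]_n) := (eps ^+ n)^-1 * phi (enorm x / eps).

Lemma measurable_enorm_tuple :
  measurable_fun setT (fun t : n.-tuple R => enorm (col_of_tuple t)).
Proof.
apply: (@measurableT_comp _ _ _ _ _ _ (@Num.sqrt R)).
  by apply: continuous_measurable_fun; exact: sqrt_continuous.
apply: measurable_sum => i; under eq_fun do rewrite mxE.
by apply: measurable_funX; exact: measurable_tnth.
Qed.

(** [g] is monotone on [0, +oo[ only; truncating its argument at 0 makes it monotone on the line and
    changes nothing on the values of [h]. *)
Lemma measurable_radial (g : R -> R) (h : n.-tuple R -> R) :
  (forall r s : R, 0 <= r -> r <= s -> g s <= g r) ->
  measurable_fun setT h -> (forall t, 0 <= h t) ->
  measurable_fun setT (g \o h).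
Proof.
move=> g_ni mh h0; rewrite (_ : g \o h = (fun r => g (Num.max r 0)) \o h).
  apply: measurableT_comp => //; apply: nonincreasing_measurable => // r s rs.
  apply: g_ni; first by rewrite le_max lexx orbT.
  by rewrite ge_max !le_max rs lexx orbT.
by apply/funext => t /=; rewrite max_l.
Qed.

Lemma measurable_phi_ eps : 0 < eps ->
  measurable_fun setT (fun t : n.-tuple R => phi_ eps (col_of_tuple t)).
Proof.
move=> eps0; apply: measurable_funM; first exact: measurable_cst.
apply: (measurable_radial phi_ni); last first.
  by move=> t; rewrite divr_ge0 ?enorm_ge0 ?ltW.
by apply: measurable_funM; [exact: measurable_enorm_tuple|exact: measurable_cst].
Qed.

Lemma measurable_phi :
  measurable_fun setT (fun t : n.-tuple R => phi (enorm (col_of_tuple t))).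
Proof.
apply: (measurable_radial phi_ni); first exact: measurable_enorm_tuple.
by move=> t; exact: enorm_ge0.
Qed.

(* Since (1 + |x_i|)^2 <= 2 (|x|^2 + 1) for each i, a radial power weight is
   dominated by a product of one-dimensional ones, to which Tonelli applies. *)
Lemma phi_prod_bound : exists K : R, forall t : n.-tuple R,
  phi (enorm (col_of_tuple t)) <=
  K * \prod_i (1 + `|tnth t i|) `^ (- (1 + 2 * alpha / n%:R)).
Proof.
have nR : 0 < n%:R :> R by rewrite ltr0n.
(* Chosen so that n factors s^(-g/2) make s^(-(n/2 + alpha)); g > 1 gives one-dimensional
   integrability. *)
set g := 1 + 2 * alpha / n%:R.
have g0 : 0 < g by rewrite ltr_pwDl// divr_ge0 ?mulr_ge0 ?ltW.
have C0 : 0 <= C.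
  have := le_trans (ltW (phi_gt0 (lexx 0))) (phi_decay (lexx 0)).
  by rewrite pmulr_lge0// powR_gt0// expr0n/= add0r.
exists (C * (2 `^ (g / 2)) ^+ n) => t.
apply: (le_trans (phi_decay (enorm_ge0 _))); rewrite -mulrA ler_wpM2l//.
set s := _ + 1.
have -> : s `^ (- (n%:R / 2 + alpha)) = \prod_(i < n) s `^ (- (g / 2)).
  rewrite prodr_const card_ord -powR_mulrn ?powR_ge0// -powRrM.
  by congr (_ `^ _); rewrite /g; field; rewrite gt_eqF.
have -> : (2 `^ (g / 2)) ^+ n = \prod_(i < n) 2 `^ (g / 2) :> R.
  by rewrite prodr_const card_ord.
rewrite -big_split/=.
apply: ler_prod => i _; rewrite powR_ge0/=.
set y := 1 + `|tnth t i|; have y0 : 0 < y by rewrite ltr_pwDl.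
have ys : y ^+ 2 <= 2 * s.
  have : `|tnth t i| ^+ 2 <= enorm (col_of_tuple t) ^+ 2.
    rewrite enorm_sqr (bigD1 i)//= mxE real_normK ?num_real// lerDl.
    by apply: sumr_ge0 => j _; exact: sqr_ge0.
  rewrite /y /s; have := sqr_ge0 (1 - `|tnth t i|); nra.
have s0 : 0 < s by rewrite ltr_wpDl// sqr_ge0.
have -> : y `^ (- g) = (y ^+ 2) `^ (- (g / 2)).
  rewrite -powR_mulrn ?(ltW y0)// -powRrM; congr (_ `^ _).
  by field.
rewrite !powRN ler_pdivlMr ?powR_gt0 ?exprn_gt0// mulrC ler_pdivrMr ?powR_gt0//.
rewrite -powRM ?(ltW s0)//; apply: ge0_ler_powR => //.
- by rewrite divr_ge0// ltW.
- by rewrite nnegrE exprn_ge0// ltW.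
- by rewrite nnegrE mulr_ge0// ltW.
Qed.

Lemma integrable_phi : integrable_Rn (fun x : 'cV[R]_n => phi (enorm x)).
Proof.
have [K phiK] := phi_prod_bound.
have g1 : 1 < 1 + 2 * alpha / n%:R.
  by rewrite ltrDl divr_gt0 ?mulr_gt0 ?ltr0n.
have w0 (x : R) : 0 <= (1 + `|x|) `^ (- (1 + 2 * alpha / n%:R)) by exact: powR_ge0.
have mw : measurable_fun setT (fun x : R => (1 + `|x|) `^ (- (1 + 2 * alpha / n%:R))).
  by apply: continuous_measurable_fun; exact: continuous_powR_1Dnorm.
have mprod : measurable_fun setT (fun t : n.-tuple R =>
    \prod_i (1 + `|tnth t i|) `^ (- (1 + 2 * alpha / n%:R))).
  apply: measurable_prod => i _.
  by apply: (measurableT_comp mw); exact: measurable_tnth.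
have iprod : mu.-integrable setT (fun t : n.-tuple R =>
    (\prod_i (1 + `|tnth t i|) `^ (- (1 + 2 * alpha / n%:R)))%:E).
  apply/integrableP; split; first exact/measurable_EFinP.
  under eq_integral do rewrite gee0_abs ?lee_fin ?prodr_ge0//.
  exact: (integral_lebesgue_tuple_prod_lty n mw w0 (integral_powR_1Dnorm_lty g1)).
apply: (le_integrable _ _ _ (integrableZl _ K iprod)) => //.
  by apply/measurable_EFinP; exact: measurable_phi.
move=> t _; rewrite -EFinM lee_fin ger0_norm ?(le_trans (phiK t)) ?ler_norm//.
by apply/ltW/phi_gt0; exact: enorm_ge0.
Qed.

(** The substitution x = eps y cancels the factor eps^(-n). *)
Lemma integrable_phi_ eps : 0 < eps -> integrable_Rn (phi_ eps).
Proof.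
move=> eps0; have epsn0 : 0 < (eps ^+ n)^-1 by rewrite invr_gt0 exprn_gt0.
have phi0 (t : n.-tuple R) : 0 <= phi_ eps (col_of_tuple t).
  by rewrite mulr_ge0 ?(ltW epsn0)// ltW// phi_gt0// divr_ge0 ?enorm_ge0// ltW.
apply/integrableP; split; first by apply/measurable_EFinP; exact: measurable_phi_.
under eq_integral do rewrite gee0_abs ?lee_fin//.
rewrite (ge0_integral_lebesgue_tuple_scale eps0)//; last first.
  by apply/measurable_EFinP; exact: measurable_phi_.
under eq_integral => t _.
  rewrite /phi_ col_of_tuple_scale enormZ ?(ltW eps0)// mulrAC divff ?gt_eqF//.
  rewrite mul1r EFinM.
  over.
have phioo := integrable_lty measurableT integrable_phi.
rewrite ge0_integralZl_EFin ?(ltW epsn0)//; last 2 first.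
- by move=> t _; rewrite lee_fin ltW// phi_gt0// enorm_ge0.
- by apply/measurable_EFinP; exact: measurable_phi.
rewrite muleA -EFinM divff ?mul1e// gt_eqF//.
by rewrite exprn_gt0.
Qed.

(** A zero integral would make [phi] vanish almost everywhere, so the whole space would be null. *)
Lemma integral_phi_gt0 : 0 < integral_Rn (fun x : 'cV[R]_n => phi (enorm x)).
Proof.
have phi0 (t : n.-tuple R) : 0 < phi (enorm (col_of_tuple t)).
  by rewrite phi_gt0// enorm_ge0.
have I0 : (0 <= \int[mu]_t (phi (enorm (col_of_tuple t)))%:E)%E.
  by apply: integral_ge0 => t _; rewrite lee_fin ltW.
apply: fine_gt0; apply/andP; split; last first.
  by rewrite -ge0_fin_numE//; exact: integrable_fin_num integrable_phi.
rewrite lt_neqAle I0 andbT eq_sym; apply/eqP => I_eq0.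
have mphi : measurable_fun setT (fun t : n.-tuple R => (phi (enorm (col_of_tuple t)))%:E).
  by apply/measurable_EFinP; exact: measurable_phi.
have /(ae_eq_integral_abs _ measurableT mphi)[N [mN N0 TN]] :
    (\int[mu]_t `|(phi (enorm (col_of_tuple t)))%:E|)%E = 0%E.
  by under eq_integral do rewrite gee0_abs ?lee_fin ?ltW//.
have NT : N = setT.
  apply/seteqP; split=> // t _; apply: TN => /= /(_ I) [] /eqP.
  by rewrite gt_eqF.
by have := @lebesgue_tuple_setT_gt0 R n; rewrite -NT N0 ltxx.
Qed.

(** After x = eps y the integrand psi(eps y) phi(|y|) is dominated by M phi(|y|) and tends pointwise
    to psi(0) phi(|y|). *)
Lemma weak_cvg_phi_ :
  weak_cvg_delta phi_ (integral_Rn (fun x : 'cV[R]_n => phi (enorm x))).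
Proof.
(* Dominated convergence is sequential, so the one-sided limit is tested along sequences. *)
move=> psi cpsi [M psiM]; apply/cvg_at_rightP => u [u0 ucvg].
have phi0 (t : n.-tuple R) : 0 < phi (enorm (col_of_tuple t)).
  by rewrite phi_gt0// enorm_ge0.
pose f k (t : n.-tuple R) :=
  (psi (u k *: col_of_tuple t) * phi (enorm (col_of_tuple t)))%:E.
have cscale (a : R) : continuous (fun x : 'cV[R]_n => psi (a *: x)).
  move=> x; apply: (@continuous_comp _ _ _ (fun x : 'cV[R]_n => a *: x) psi).
    exact: scaler_continuous.
  exact: cpsi.
have mf k : measurable_fun setT (f k).
  apply/measurable_EFinP/measurable_funM; last exact: measurable_phi.
  exact: continuous_measurable_tuple (cscale (u k)).
have M0 : 0 <= M by exact: le_trans (psiM 0).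
have iM : mu.-integrable setT
    (fun t : n.-tuple R => (M%:E * (phi (enorm (col_of_tuple t)))%:E)%E).
  by apply: integrableZl => //; exact: integrable_phi.
have fM k t : (`|f k t| <= M%:E * (phi (enorm (col_of_tuple t)))%:E)%E.
  by rewrite -EFinM lee_fin normrM (gtr0_norm (phi0 t)) ler_wpM2r// ltW.
have intf k : integral_Rn (fun x => psi x * phi_ (u k) x) = fine (\int[mu]_t f k t).
  have uk0 := u0 k.
  have E x : psi (u k *: x) * phi_ (u k) (u k *: x) =
      (u k ^+ n)^-1 * (psi (u k *: x) * phi (enorm x)).
    by rewrite /phi_ enormZ ?(ltW uk0)// mulrAC divff ?gt_eqF// mul1r mulrCA.
  have ifk : mu.-integrable setT (f k).
    by apply: le_integrable iM => // t _; rewrite (le_trans (fM k t))// lee_abs.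
  rewrite (integral_Rn_scale uk0); last 2 first.
  - apply: measurable_funM; first exact: continuous_measurable_tuple.
    exact: measurable_phi_.
  - rewrite /integrable_Rn; under eq_fun do rewrite E EFinM.
    exact: integrableZl.
  rewrite /integral_Rn; under eq_Rintegral do rewrite E.
  rewrite RintegralZl// mulrA divff ?mul1r// gt_eqF//.
  by rewrite exprn_gt0.
under eq_fun do rewrite intf.
have psi0 t : psi (u k *: col_of_tuple t) @[k --> \oo] --> psi (0 : 'cV[R]_n).
  apply: continuous_cvg; first exact: cpsi.
  by rewrite -(scale0r (col_of_tuple t)); apply: cvgZr_tmp.
have -> : integral_Rn (fun x : 'cV[R]_n => phi (enorm x)) * psi 0 =
    fine (\int[mu]_t (psi 0 * phi (enorm (col_of_tuple t)))%:E).
  rewrite mulrC -(RintegralZl _ measurableT)//; exact: integrable_phi.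
apply: fine_cvg; rewrite fineK; last first.
  rewrite integrable_fin_num//; under eq_fun do rewrite EFinM.
  by apply: integrableZl => //; exact: integrable_phi.
have [] := @dominated_convergence _ _ _ mu setT measurableT f
  (fun t => (psi 0 * phi (enorm (col_of_tuple t)))%:E) _ mf _ _ iM _.
- by apply/measurable_EFinP/measurable_funM => //; exact: measurable_phi.
- apply: aeW => t _; apply: cvg_EFin; first by near=> k.
  by apply: cvgM; [exact: psi0|exact: cvg_cst].
- by apply: aeW => t k _; exact: fM.
- by [].
Unshelve. all: by end_near. Qed.

End radial_approximate_delta.

(** * Reduction to the ray *)

Section radial_reduction.
Local Set Implicit Arguments.
Local Unset Strict Implicit.
Context {R : realType} {n : nat}.
Variables (F G : set 'M[R]_n) (f : 'M[R]_n -> R) (p m : R) (e : 'cV[R]_n).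
Hypothesis hF : cone_subequation F.
Hypothesis hG : orthogonal_subgroup G.
Hypothesis hGtrans : sphere_transitive G.
Hypothesis hFG : set_invariant G F.
Hypothesis he : e != 0.
Hypothesis hp : riesz_char F e = p%:E.
Hypothesis p0 : 0 < p.
Hypothesis hfG : fun_invariant G F f.
Hypothesis hfhom : homogeneous F f m.

Lemma enorm_normalize (x : 'cV[R]_n) : x != 0 -> enorm ((enorm x)^-1 *: x) = 1.
Proof.
move=> x0; have ex := enorm_gt0 x0.
by rewrite enormZ ?invr_ge0 ?enorm_ge0// mulVf// gt_eqF.
Qed.

Lemma outerZ (a : R) (x : 'cV[R]_n) :
  (a *: x) *m (a *: x)^T = a ^+ 2 *: (x *m x^T).
Proof. by rewrite linearZ/= -scalemxAr -scalemxAl scalerA expr2. Qed.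

(** Transitivity carries e/|e| to x/|x|, and conjugation by that g carries P_e to the projection
    onto the line of x; for x = 0 both sides vanish. *)
Lemma outer_conj_proj_line (x : 'cV[R]_n) : exists2 g, G g &
  x *m x^T = enorm x ^+ 2 *: (g *m proj_line e *m g^T).
Proof.
have [_ G1 _ _] := hG.
have [->|x0] := eqVneq x 0.
  exists 1%:M => //; rewrite mul0mx.
  rewrite (_ : enorm 0 = 0) ?expr0n ?scale0r//.
  by rewrite -(scale0r 0) enormZ// mul0r.
have [g Gg gx] := hGtrans (enorm_normalize he) (enorm_normalize x0).
exists g => //; have ex := enorm_gt0 x0.
have -> : x = enorm x *: (g *m ((enorm e)^-1 *: e)).
  by rewrite gx scalerA divff ?gt_eqF// scale1r.
rewrite enormZ ?enorm_ge0// gx enorm_normalize// mulr1 -gx.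
by rewrite outerZ trmx_mul -mulmxA [X in g *m X]mulmxA outerZ exprVn mulmxA.
Qed.

(** The Hessian is q^(-p/2) times a conjugate of a ray matrix with parameter at most p, hence in
    [F], where invariance and homogeneity apply. *)
Lemma f_hessian_riesz_kernel_eps (eps : R) (x : 'cV[R]_n) : 0 < eps ->
  f (hessian (riesz_kernel_eps p eps) x) =
  ((enorm x ^+ 2 + eps ^+ 2) `^ (- (p / 2))) `^ m *
  f (riesz_ray e (p * (enorm x ^+ 2 / (enorm x ^+ 2 + eps ^+ 2)))).
Proof.
move=> eps0; rewrite hessian_riesz_kernel_eps//.
set q := enorm x ^+ 2 + eps ^+ 2.
have q0 : 0 < q by rewrite ltr_wpDl ?sqr_ge0// exprn_gt0.
have [g Gg ->] := outer_conj_proj_line x.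
have gK : g *m g^T = 1%:M by have [/(_ _ Gg)/mulmx1C] := hG.
have -> : 1%:M - (p / q) *: (enorm x ^+ 2 *: (g *m proj_line e *m g^T)) =
    g *m riesz_ray e (p * (enorm x ^+ 2 / q)) *m g^T.
  rewrite /riesz_ray; move: (proj_line e) => P.
  rewrite mulmxBr mulmxBl mulmx1 gK scalerA -scalemxAr -scalemxAl.
  by congr (_ - _ *: _); rewrite -mulrA [_^-1 * _]mulrC.
have Fray : F (riesz_ray e (p * (enorm x ^+ 2 / q))).
  apply: (ray_mem hF hp).
  by rewrite ger_pMr// ler_pdivrMr// mul1r lerDl sqr_ge0.
by rewrite hfhom ?hfG ?powR_gt0//; exact: hFG.
Qed.

End radial_reduction.

(** * Scaling identity, uniqueness of the exponent and the delta limit *)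

Theorem theorem7p4 (R : realType) (n : nat) (hn : (0 < n)%N)
    (F G : set 'M[R]_n) (f : 'M[R]_n -> R) (p m : R) (e : 'cV[R]_n)
    (hF : cone_subequation F)
    (hG : orthogonal_subgroup G) (hGtrans : sphere_transitive G)
    (hFG : set_invariant G F)
    (he : e != 0) (hp : riesz_char F e = p%:E) (hp1 : 1 <= p)
    (hfsmooth : smooth_on F f)
    (hfG : fun_invariant G F f)
    (hfell : degenerate_elliptic F f)
    (hm : 0 < m) (hfhom : homogeneous F f m)
    (hfcompat : compatible F f) :
  let K (eps : R) := @riesz_kernel_eps R n p eps in
  let alpha := n%:R / (m * p) in
  exists phi : R -> R,
    let phi_ (eps : R) (x : 'cV[R]_n) := (eps ^+ n)^-1 * phi (enorm x / eps) in
    [/\ forall x : 'cV[R]_n, phi (enorm x) = f (hessian (K 1) x) `^ alpha,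
        forall (eps : R) (x : 'cV[R]_n), 0 < eps -> f (hessian (K eps) x) `^ alpha = phi_ eps x,
        forall (alpha' : R) (phi' : R -> R), 0 < alpha' ->
          (forall x : 'cV[R]_n, phi' (enorm x) = f (hessian (K 1) x) `^ alpha') ->
          (forall (eps : R) (x : 'cV[R]_n), 0 < eps ->
             f (hessian (K eps) x) `^ alpha' =
             (eps ^+ n)^-1 * phi' (enorm x / eps)) ->
          alpha' = alpha,
        (forall eps : R, 0 < eps -> integrable_Rn (phi_ eps)) /\
        (forall (eps : R) (x : 'cV[R]_n), 0 < eps -> 0 < phi_ eps x) &
        let c := integral_Rn (fun x : 'cV[R]_n => phi (enorm x)) in
        0 < c /\ weak_cvg_delta phi_ c].
Proof.
move=> K alpha; have p0 : 0 < p by exact: lt_le_trans hp1.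
have nR : 0 < n%:R :> R by rewrite ltr0n.
have alpha0 : 0 < alpha by rewrite divr_gt0// mulr_gt0.
(* The ray parameter of the Hessian, as a function of r = |x|/eps alone. *)
pose rho (r : R) := p * (r ^+ 2 / (r ^+ 2 + 1)).
have r1 (r : R) : 0 < r ^+ 2 + 1 by rewrite ltr_wpDl// sqr_ge0.
have rho_ge0 r : 0 <= rho r.
  by rewrite mulr_ge0 ?divr_ge0 ?sqr_ge0 ?(ltW p0)// ltW.
(* This r^(-2) gap to the endpoint is the source of the extra decay of [phi]. *)
have rho_gap r : p - rho r = p / (r ^+ 2 + 1).
  by rewrite /rho; field; rewrite gt_eqF.
have rho_lt r : rho r < p by rewrite -subr_gt0 rho_gap divr_gt0.
have fray_gt0 r : 0 < f (riesz_ray e (rho r)).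
  exact: (f_ray_gt0 hF hp hfell hfhom hfcompat).
(* The exponent [b] is arbitrary: b = [alpha] gives the scaling identity, any competitor enters the
   uniqueness argument. *)
have fE (eps b : R) (x : 'cV[R]_n) : 0 < eps -> f (hessian (K eps) x) `^ b =
    eps `^ (- (p * m * b)) * (((enorm x / eps) ^+ 2 + 1) `^ (- (p * m * b / 2)) *
    f (riesz_ray e (rho (enorm x / eps))) `^ b).
  move=> eps0.
  rewrite (f_hessian_riesz_kernel_eps hF hG hGtrans hFG he hp p0 hfG hfhom)//.
  have -> : enorm x ^+ 2 / (enorm x ^+ 2 + eps ^+ 2) =
      (enorm x / eps) ^+ 2 / ((enorm x / eps) ^+ 2 + 1).
    by field; rewrite !gt_eqF// ltr_wpDl ?sqr_ge0// exprn_gt0.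
  have -> : enorm x ^+ 2 + eps ^+ 2 = eps `^ 2 * ((enorm x / eps) ^+ 2 + 1).
    by rewrite powR_mulrn ?ltW//; field; rewrite gt_eqF.
  rewrite powRM ?powR_ge0// ?(ltW (fray_gt0 _))// -!powRrM powRM ?powR_ge0// ?ltW//.
  rewrite -powRrM -mulrA.
  have -> : 2 * (- (p / 2) * (m * b)) = - (p * m * b) by field.
  by have -> : - (p / 2) * (m * b) = - (p * m * b / 2) by field.
pose phi (r : R) := (r ^+ 2 + 1) `^ (- (n%:R / 2)) * f (riesz_ray e (rho r)) `^ alpha.
have pma : p * m * alpha = n%:R by rewrite /alpha; field; rewrite !gt_eqF.
have phi_gt0 r : 0 <= r -> 0 < phi r by move=> _; rewrite mulr_gt0 ?powR_gt0.
(* Both factors decrease: [rho] increases with r, and [f] decreases along the ray. *)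
have phi_ni r s : 0 <= r -> r <= s -> phi s <= phi r.
  move=> r0 rs.
  have rs2 : r ^+ 2 + 1 <= s ^+ 2 + 1 by rewrite lerD2r ler_pXn2r// nnegrE (le_trans r0).
  apply: ler_pM; rewrite ?powR_ge0//.
    rewrite !powRN lef_pV2 ?posrE ?powR_gt0//.
    by apply: ge0_ler_powR; rewrite ?nnegrE ?(ltW (r1 _))// divr_ge0.
  apply: ge0_ler_powR; rewrite ?nnegrE ?(ltW alpha0) ?(ltW (fray_gt0 _))//.
  apply: (f_ray_le hF hp hfell); last exact: ltW.
  by rewrite -lerN2 -(lerD2l p) !rho_gap ler_pM2l// lef_pV2 ?posrE.
have [C C0 fC] := f_ray_linear_bound hF hp hfell hfhom hfcompat hfsmooth p0.
(* The linear bound gives f <= C p/(r^2 + 1); its power [alpha] is the extra factor. *)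
have phi_decay r : 0 <= r ->
    phi r <= (C * p) `^ alpha * (r ^+ 2 + 1) `^ (- (n%:R / 2 + alpha)).
  move=> _; rewrite opprD powRD; last by rewrite (gt_eqF (r1 r)) implybT.
  rewrite [leRHS]mulrCA ler_wpM2l ?powR_ge0//.
  rewrite (_ : _ `^ (- alpha) = (r ^+ 2 + 1)^-1 `^ alpha); last first.
    by rewrite -powR_inv1 ?(ltW (r1 _))// -powRrM mulN1r.
  have r1V : 0 <= (r ^+ 2 + 1)^-1 by rewrite invr_ge0 ltW.
  have Cp : 0 <= C * p by rewrite mulr_ge0 ?ltW.
  rewrite -powRM//.
  apply: ge0_ler_powR; rewrite ?nnegrE ?(ltW alpha0) ?(ltW (fray_gt0 _))//.
    exact: mulr_ge0.
  by rewrite (le_trans (fC _ (rho_ge0 r) (ltW (rho_lt r))))// rho_gap mulrA.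
exists phi; split.
- move=> x; by rewrite fE// pma powR1 mul1r divr1.
- move=> eps x eps0; rewrite fE// pma powR_invn ?ltW//.
- move=> b phi' b0 phi'E scale.
  have e0 : enorm (0 : 'cV[R]_n) = 0 by rewrite -(scale0r 0) enormZ// mul0r.
  (* Comparing eps = 2 with eps = 1 at x = 0 and cancelling a positive factor leaves 2^(-p m b) =
     2^(-n). *)
  have := etrans (phi'E 0) (fE 1 b 0 ltr01).
  have := etrans (esym (fE 2 b 0 (ltr0Sn _ _))) (scale 2 0 (ltr0Sn _ _)).
  rewrite e0 !mul0r => + phi'0; rewrite {}phi'0 powR1 mul1r.
  move=> /(mulIf _); rewrite -powR_invn//.
  rewrite gt_eqF ?mulr_gt0 ?powR_gt0// => /(_ isT)/(congr1 (@ln R)).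
  rewrite !ln_powR => /(mulIf _).
  rewrite gt_eqF ?ln_gt0 ?ltr1n// => /(_ isT)/oppr_inj pmb.
  by rewrite /alpha -pmb; field; rewrite !gt_eqF.
- split=> [eps eps0|eps x eps0].
    exact: (integrable_phi_ hn alpha0 phi_gt0 phi_ni phi_decay).
  by rewrite mulr_gt0 ?invr_gt0 ?exprn_gt0 ?phi_gt0// divr_ge0 ?enorm_ge0// ltW.
- split; first exact: (integral_phi_gt0 hn alpha0 phi_gt0 phi_ni phi_decay).
  exact: (weak_cvg_phi_ hn alpha0 phi_gt0 phi_ni phi_decay).
Qed.
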